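(* Let $\kappa \leq \lambda$ be cardinals such that $\kappa$ is $\lambda^+$-$\Pi^1_1$-subcompact. Then $\kappa$ has the $\lambda$-filter extension property. In particular, every $\kappa^+$-$\Pi^1_1$-subcompact cardinal $\kappa$ is $\kappa$-compact.
   Context: For cardinals $\kappa\le\mu$, $\kappa$ is $\mu$-$\Pi^1_1$-subcompact if for every $A\subseteq H(\mu)$ and every $\Pi^1_1$-statement $\Phi$ (a second-order statement consisting of a universal second-order quantifier over subsets of the universe followed by a first-order formula), if $\langle H(\mu),\in,A\rangle\models\Phi$ then there are $\rho<\kappa$, $\bar\mu<\kappa$ and $B\subseteq H(\bar\mu)$ such that $\langle H(\bar\mu),\in,B\rangle\models\Phi$ and there is an elementary embedding $j\colon\langle H(\bar\mu),\in,B\rangle\to\langle H(\mu),\in,A\rangle$ with critical point $\rho$ and $j(\rho)=\kappa$. $\kappa$ has the $\lambda$-filter extension property if every $\kappa$-complete filter on $\lambda$ can be extended to a $\kappa$-complete ultrafilter on $\lambda$; $\kappa$ is $\kappa$-compact if it has the $\kappa$-filter extension property. *)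

(* Defs.v *)
From mathcomp Require Import all_boot.
From mathcomp Require Import boolp classical_sets functions cardinality filter.
Set Implicit Arguments.
Unset Strict Implicit.
Unset Printing Implicit Defensive.
Local Open Scope classical_set_scope.
Local Open Scope card_scope.

(** * The set-theoretic universe *)

Declare Scope zfc_scope.
Delimit Scope zfc_scope with zfc.
Reserved Notation "x ∈ y" (at level 70, no associativity).
Reserved Notation "x ⊆ y" (at level 70, no associativity).

(* A universe of sets satisfying ZFC. "Classes" are arbitrary predicates of the
   ambient logic, so the two schemas are single axioms quantifying over them.
   Consequently the natural numbers of the universe are the standard ones, and
   first-order formulas can be taken to be elements of an inductive type. *)
Record zfcUniverse := ZFCUniverse {
  zsort :> Type;
  zin : zsort -> zsort -> Prop where "x ∈ y" := (zin x y);
  zfc_extensionality : forall x y, (forall z, z ∈ x <-> z ∈ y) -> x = y;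
  zfc_foundation : forall x, (exists y, y ∈ x) ->
    exists2 y, y ∈ x & forall z, z ∈ x -> ~ z ∈ y;
  zfc_pairing : forall x y, exists p, forall z, z ∈ p <-> z = x \/ z = y;
  zfc_union : forall x, exists u, forall z, z ∈ u <-> exists2 y, y ∈ x & z ∈ y;
  zfc_powerset : forall x, exists p, forall y,
    y ∈ p <-> (forall z, z ∈ y -> z ∈ x);
  zfc_infinity : exists w,
    (exists2 e, e ∈ w & forall z, ~ z ∈ e) /\
    (forall x, x ∈ w -> exists2 s, s ∈ w & forall z, z ∈ s <-> z ∈ x \/ z = x);
  zfc_separation : forall (P : zsort -> Prop) x,
    exists y, forall z, z ∈ y <-> z ∈ x /\ P z;
  zfc_replacement : forall (R : zsort -> zsort -> Prop) x,
    (forall y z z', y ∈ x -> R y z -> R y z' -> z = z') ->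
    exists u, forall z, z ∈ u <-> exists2 y, y ∈ x & R y z;
  zfc_choice : forall x,
    (forall y, y ∈ x -> exists z, z ∈ y) ->
    (forall y y', y ∈ x -> y' ∈ x -> (exists z, z ∈ y /\ z ∈ y') -> y = y') ->
    exists c, forall y, y ∈ x -> exists! z, z ∈ y /\ z ∈ c
}.

Notation "x ∈ y" := (zin x y) : zfc_scope.
Notation "x ⊆ y" := (forall z, zin z x -> zin z y) : zfc_scope.
Local Open Scope zfc_scope.

(** * Ordinals, cardinals and H(mu) *)

Section SetTheory.
Variable V : zfcUniverse.
Implicit Types (a x y kappa lambda mu : V).

Definition elts x : set V := [set z | z ∈ x].

Definition transitive_set x := forall y, y ∈ x -> y ⊆ x.

Definition is_ordinal a :=
  transitive_set a /\
  [/\ forall x, x ∈ a -> ~ x ∈ x,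
      forall x y z, x ∈ a -> y ∈ a -> z ∈ a -> x ∈ y -> y ∈ z -> x ∈ z,
      forall x y, x ∈ a -> y ∈ a -> [\/ x ∈ y, x = y | y ∈ x] &
      forall s, s ⊆ a -> (exists x, x ∈ s) ->
        exists2 m, m ∈ s & forall x, x ∈ s -> m = x \/ m ∈ x].

Definition ord_le x y := x ∈ y \/ x = y.

Definition is_cardinal kappa :=
  is_ordinal kappa /\ forall a, a ∈ kappa -> ~ (elts a #= elts kappa).

Definition is_succ_cardinal lambda mu :=
  [/\ is_cardinal mu, lambda ∈ mu &
      forall nu, is_cardinal nu -> lambda ∈ nu -> ord_le mu nu].

(* |A| < mu, for mu a cardinal. *)
Definition card_lt (U : Type) (A : set U) mu :=
  exists2 a, a ∈ mu & A #= elts a.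

Definition is_transitive_closure x t :=
  [/\ transitive_set t, x ⊆ t &
      forall s, transitive_set s -> x ⊆ s -> t ⊆ s].

Definition in_H mu x :=
  exists2 t, is_transitive_closure x t & card_lt (elts t) mu.

Definition H mu := {x : V | in_H mu x}.

Definition H_mem mu (x y : H mu) : Prop := proj1_sig x ∈ proj1_sig y.

Definition subset_of_H mu A := forall x, x ∈ A -> in_H mu x.

End SetTheory.

(** * First-order and Pi^1_1 formulas in the language of set theory *)

(* The n free variables of a formula; in the body of a quantifier, [None] is the
   variable just bound and [Some v] the variable v of the context. *)
Fixpoint var (n : nat) : Type := if n is m.+1 then option (var m) else void.

(* First-order formulas with membership, equality and a unary predicate symbol
   for each element of P. *)
Inductive form (P : Type) : nat -> Type :=
| FMem n of var n & var n : form P n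
| FEq n of var n & var n : form P n
| FPred n of P & var n : form P n
| FFalse n : form P n
| FImp n of form P n & form P n : form P n
| FAll n of form P n.+1 : form P n.

Definition env_cons (M : Type) n (x : M) (v : var n -> M) : var n.+1 -> M :=
  fun i => if i is Some j then v j else x.

Definition env_nil (M : Type) : var 0 -> M := of_void M.

Fixpoint sat (M : Type) (E : M -> M -> Prop) (P : Type) (I : P -> M -> Prop)
    n (phi : form P n) : (var n -> M) -> Prop :=
  match phi with
  | FMem _ i j => fun v => E (v i) (v j)
  | FEq _ i j => fun v => v i = v j
  | FPred _ p i => fun v => I p (v i)
  | FFalse _ => fun _ => False
  | FImp _ f g => fun v => sat E I f v -> sat E I g v
  | FAll _ f => fun v => forall x, sat E I f (env_cons x v)
  end.

Section Subcompact.
Variable V : zfcUniverse.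
Implicit Types (A B X kappa lambda mu rho : V).

(* The language of <H(mu), ∈, A> has one predicate symbol, [tt]. *)
Definition pred1_interp mu A (_ : unit) (x : H mu) : Prop := proj1_sig x ∈ A.

(* A Pi^1_1 sentence "for all X, phi" is given by its first-order matrix phi,
   without free first-order variables, where [false] is the predicate symbol of
   the structure and [true] is the quantified second-order variable X. *)
Definition Pi11_sentence := form bool 0.

Definition pred2_interp mu A X (p : bool) (x : H mu) : Prop :=
  proj1_sig x ∈ (if p then X else A).

Definition sat_Pi11 mu A (Phi : Pi11_sentence) : Prop :=
  forall X, subset_of_H mu X ->
    sat (@H_mem V mu) (@pred2_interp mu A X) Phi (@env_nil (H mu)).

Definition elementary mubar B mu A (j : H mubar -> H mu) : Prop :=
  forall n (phi : form unit n) (v : var n -> H mubar),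
    sat (@H_mem V mubar) (@pred1_interp mubar B) phi v <->
    sat (@H_mem V mu) (@pred1_interp mu A) phi (fun i => j (v i)).

Definition critical_point mubar mu (j : H mubar -> H mu) (r : H mubar) : Prop :=
  [/\ is_ordinal (proj1_sig r), proj1_sig (j r) <> proj1_sig r &
      forall a : H mubar, proj1_sig a ∈ proj1_sig r ->
        proj1_sig (j a) = proj1_sig a].

Definition Pi11_subcompact mu kappa : Prop :=
  forall A, subset_of_H mu A ->
  forall Phi : Pi11_sentence, sat_Pi11 mu A Phi ->
  exists rho mubar B,
    [/\ rho ∈ kappa, is_cardinal mubar /\ mubar ∈ kappa,
        subset_of_H mubar B, sat_Pi11 mubar B Phi &
        exists j : H mubar -> H mu, elementary B A j /\
          exists r : H mubar,
            [/\ proj1_sig r = rho, critical_point j r &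
                proj1_sig (j r) = kappa]].

(** * Filter extension *)

Definition kcomplete kappa (T : Type) (F : set_system T) : Prop :=
  forall D : set (set T), D `<=` F -> card_lt D kappa -> F (\bigcap_(X in D) X).

(* Filters on the set lambda are filters on the type of its elements; as usual
   they are proper. *)
Definition filter_extension_property lambda kappa : Prop :=
  forall F : set_system {x : V | x ∈ lambda},
    ProperFilter F -> kcomplete kappa F ->
    exists U : set_system {x : V | x ∈ lambda},
      [/\ UltraFilter U, kcomplete kappa U & F `<=` U].

Definition self_compact kappa : Prop := filter_extension_property kappa kappa.

End Subcompact.

(* Main.v *)
Require Import Defs.
From mathcomp Require Import all_boot.
From mathcomp Require Import boolp classical_sets functions cardinality filter.

(** Let F be a kappa-complete filter on lambda without kappa-complete ultrafilter
    extension. Code F, together with an enumeration of every family of fewer than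
    kappa subsets of lambda, in a set A included in H(lambda^+). That F has no
    extension is then a Pi^1_1 statement about A. Reflect it to H(mubar) along an
    elementary j with critical point rho and j(rho) = kappa. Since kappa is a
    strong limit, there are fewer than kappa sets j(x), for x in the reflected
    filter; they belong to F, so they share a point b. Then {x | b \in j(x)} is an
    ultrafilter extending the reflected filter, and it is rho-complete because j
    fixes the indices of families of size below rho: a contradiction. *)

Set Implicit Arguments.
Unset Strict Implicit.
Unset Printing Implicit Defensive.
Local Open Scope classical_set_scope.
Local Open Scope card_scope.
Local Open Scope zfc_scope.

(** * Cardinality *)

(** The successor of lambda enters because H(lambda^+) has as elements all subsets of lambda and all
    families of fewer than kappa of them, while an ultrafilter on lambda is only a subset of it: a
    single second-order quantifier then ranges over the candidates. The obstacle is completeness. An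
    embedding sends the code D of a family to j(D), whose members need not be images of members of
    D. Storing numbered members in A removes it: the numbers used by j(D) are bounded below kappa =
    j(rho), so those used by D are bounded by some g below rho, and j(g) = g bounds the former
    again. Each number a used by j(D) is thus fixed by j, and member number a of j(D) is the image
    of member number a of D. Storing the enumeration also frees the sentence from any mention of
    kappa, functions or cardinality. The strong limit property is needed because the reflected
    filter lives on a set l of size below mubar and may have as many members as l has subsets; mubar
    < kappa alone does not bound their number by kappa. *)

Lemma card_le_inj (T U : Type) (A : set T) (B : set U) (f : T -> U) :
  (forall x, A x -> B (f x)) ->
  (forall x y, A x -> A y -> f x = f y -> x = y) -> A #<= B.
Proof.
move=> fAB finj; apply: (@card_le_trans _ _ _ (f @` A)).
  have /card_esym : f @` A #= A.
    by apply: inj_card_eq => x y /set_mem Ax /set_mem Ay; exact: finj.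
  by rewrite card_eq_le => /andP[].
by apply: subset_card_le => _ [x Ax <-]; exact: fAB.
Qed.

Lemma card_le_injE (T U : Type) (u0 : U) (A : set T) (B : set U) : A #<= B ->
  exists f : T -> U, (forall x, A x -> B (f x)) /\
    (forall x y, A x -> A y -> f x = f y -> x = y).
Proof.
move=> /card_leP[f].
pose g x := if pselect (A x) is left Ax then set_val (f (SigSub (mem_set Ax)))
            else u0.
exists g; split=> [x Ax|x y Ax Ay]; rewrite /g.
  by case: pselect => // Ax'; exact: set_valP.
case: pselect => // Ax'; case: pselect => // Ay' /val_inj.
by move=> e; have := 'inj_f (in_setT _) (in_setT _) e => -[].
Qed.

Lemma card_eqW (T U : Type) (A : set T) (B : set U) :
  A #= B -> A #<= B /\ B #<= A.
Proof. by rewrite card_eq_le => /andP. Qed.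

(** * Pairs and triples inside the universe *)

Section SetTheory.
Variable V : zfcUniverse.
Implicit Types (a b c x y z t kappa lambda mu : V).

Definition zsep x (P : V -> Prop) : V := sval (cid (zfc_separation P x)).
Lemma zsepE x P z : z ∈ zsep x P <-> z ∈ x /\ P z.
Proof. exact: (svalP (cid (zfc_separation P x))). Qed.

Definition zupair x y : V := sval (cid (zfc_pairing x y)).
Lemma zupairE x y z : z ∈ zupair x y <-> z = x \/ z = y.
Proof. exact: (svalP (cid (zfc_pairing x y)) z). Qed.

Definition zpow x : V := sval (cid (zfc_powerset x)).
Lemma zpowE x y : y ∈ zpow x <-> y ⊆ x.
Proof. exact: (svalP (cid (zfc_powerset x)) y). Qed.

Definition zcup x y : V := sval (cid (zfc_union (zupair x y))).
Lemma zcupE x y z : z ∈ zcup x y <-> z ∈ x \/ z ∈ y.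
Proof.
split=> [/(svalP (cid (zfc_union (zupair x y))) z)[w /zupairE[]->]|]; try by auto.
by case=> h; apply/(svalP (cid (zfc_union (zupair x y))) z);
  [exists x|exists y] => //; apply/zupairE; auto.
Qed.

Lemma zin_irr x : ~ x ∈ x.
Proof.
have [|y] := @zfc_foundation V (zupair x x); first by exists x; apply/zupairE; left.
by move=> /zupairE[]-> h; apply: h; apply/zupairE; left.
Qed.

Lemma zin_asym x y : x ∈ y -> ~ y ∈ x.
Proof.
move=> xy yx.
have [|w] := @zfc_foundation V (zupair x y); first by exists x; apply/zupairE; left.
by move=> /zupairE[]-> h; [apply: (h y)|apply: (h x)] => //; apply/zupairE; auto.
Qed.

Definition zpair x y := zupair (zupair x x) (zupair x y).

Lemma zupair_inj x y x' y' : zupair x y = zupair x' y' ->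
  (x = x' /\ y = y') \/ (x = y' /\ y = x').
Proof.
move=> e.
have h z : (z = x \/ z = y) <-> (z = x' \/ z = y') by rewrite -!zupairE e.
have [/(_ (or_introl erefl)) hx _] := h x.
have [/(_ (or_intror erefl)) hy _] := h y.
have [_ /(_ (or_introl erefl)) hx'] := h x'.
have [_ /(_ (or_intror erefl)) hy'] := h y'.
by case: hx => ?; case: hy => ?; case: hx' => ?; case: hy' => ?; subst; auto.
Qed.

Lemma zpair_inj x y x' y' : zpair x y = zpair x' y' -> x = x' /\ y = y'.
Proof.
move=> /zupair_inj[[/zupair_inj h /zupair_inj h']|[/zupair_inj h /zupair_inj h']];
by case: h => -[? ?]; case: h' => -[? ?]; subst.
Qed.

Definition ztriple x y z := zpair x (zpair y z).

Lemma ztriple_inj x y z x' y' z' : ztriple x y z = ztriple x' y' z' ->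
  [/\ x = x', y = y' & z = z'].
Proof. by move=> /zpair_inj[-> /zpair_inj[-> ->]]. Qed.

(** Supplies the ambient set from which separation later cuts out the codes [A]. The inner pair lies
    in the double power set of [x], so the outer pair is formed over the union of both. *)
Lemma ztriple_bound x : exists w,
  forall a b c, a ∈ x -> b ∈ x -> c ∈ x -> ztriple a b c ∈ w.
Proof.
have pP y a b : a ∈ y -> b ∈ y -> zpair a b ∈ zpow (zpow y).
  by move=> ya yb; apply/zpowE => z /zupairE[]->; apply/zpowE => u /zupairE[]->.
exists (zpow (zpow (zcup x (zpow (zpow x))))) => a b c xa xb xc.
by apply: (pP); apply/zcupE; [left|right; exact: (pP)].
Qed.

(** * Ordinals and cardinals *)

(** Opens ordinals to [Fix] and well-founded induction. Separation accepts every predicate of the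
    logic, so the inaccessible points form a set; its least element would have only accessible
    predecessors. *)
Lemma ord_wf a : is_ordinal a ->
  well_founded (fun x y => [/\ x ∈ a, y ∈ a & x ∈ y]).
Proof.
move=> [aT [airr atr atot amin]] x; apply: contrapT => nx.
set bad := zsep a (fun y => ~ Acc (fun x y => [/\ x ∈ a, y ∈ a & x ∈ y]) y).
have ax : x ∈ a by apply: contrapT => nax; apply: nx; constructor=> y [].
have [||m /zsepE[am nm] mmin] := amin bad.
- by move=> z /zsepE[].
- by exists x; apply/zsepE.
apply: nm; constructor=> y [ay _ ym]; apply: contrapT => ny.
have [|my|my] := mmin y; first by apply/zsepE.
  by move: ym; rewrite my; exact: zin_irr.
exact: (zin_asym ym my).
Qed.

Lemma ord_elt a b : is_ordinal a -> b ∈ a -> is_ordinal b.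
Proof.
move=> [aT [airr atr atot amin]] ab; have sba := aT _ ab.
split=> [y yb z zy|].
  by have ya := sba _ yb; exact: (atr z y b (aT _ ya _ zy) ya ab zy yb).
split=> [x /sba|x y z /sba ? /sba ? /sba|x y /sba ? /sba|s sb]; auto.
exact: atr.
Qed.

Lemma card_ord_sub a b : is_ordinal a -> b ∈ a -> elts b #<= elts a.
Proof. by move=> [aT _] ab; apply: subset_card_le => x; exact: aT. Qed.

(* Enumerate A along kappa until it is exhausted. *)
Lemma ord_compare (U : Type) (A : set U) kappa : is_ordinal kappa ->
  elts kappa #<= A \/ card_lt A kappa.
Proof.
move=> ko; have [kT [kirr ktr ktot kmin]] := ko.
pose R x y := [/\ x ∈ kappa, y ∈ kappa & x ∈ y].
pose step (a : V) (g : forall b, R b a -> option U) : option U :=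
  if pselect (exists u, A u /\ forall b (h : R b a), g b h <> Some u) is left h
  then Some (sval (cid h)) else None.
pose g : V -> option U := Fix (ord_wf ko) (fun=> option U) step.
have gE a : g a = step a (fun b _ => g b).
  apply: (Fix_eq (ord_wf ko)) => {}a f f' ff'; congr (step a _).
  by apply: functional_extensionality_dep => b; apply: functional_extensionality_dep.
have gS a u : g a = Some u -> A u /\ forall b, R b a -> g b <> Some u.
  by rewrite gE /step; case: pselect => // h [<-]; case: cid.
have gN a u : g a = None -> A u -> exists2 b, R b a & g b = Some u.
  rewrite gE /step; case: pselect => // h _ Au; apply: contrapT => nb; apply: h.
  by exists u; split=> // b Rb gb; apply: nb; exists b.
have ginj a b u : a ∈ kappa -> b ∈ kappa -> g a = Some u -> g b = Some u -> a = b.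
  move=> ka kb ga gb; have [ab||ba] := ktot _ _ ka kb; last 1 first.
  - by have [_ /(_ b)] := gS _ _ ga; case.
  - by have [_ /(_ a)] := gS _ _ gb; case.
  - by [].
have [[a0 [ka0 ga0]]|noN] := pselect (exists a, a ∈ kappa /\ g a = None); last first.
  have gT a : a ∈ kappa -> exists u, g a = Some u.
    by move=> ka; case E: (g a) => [u|]; [exists u|case: noN; exists a].
  have [[a ka]|k0] := pselect (exists a, a ∈ kappa); last first.
    left; have -> : elts kappa = set0; last exact: card_ge0.
    by rewrite predeqE => x; split=> // kx; case: k0; exists x.
  have [u0 _] := gT _ ka; left.
  apply: (@card_le_inj _ _ _ _ (fun x => odflt u0 (g x))) => [x kx|x y kx ky].
    by have [u gu] := gT _ kx; rewrite gu; have [] := gS _ _ gu.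
  have [u gu] := gT _ kx; have [v gv] := gT _ ky; rewrite gu gv /= => uv.
  by apply: ginj kx ky gu _; rewrite uv.
right.
(* The first stage [m] at which the enumeration stops: below [m] it is total and injective, and by
   [gN] every element of [A] has been listed before [m]. *)
have [||m] := kmin (zsep kappa (fun a => g a = None)).
- by move=> z /zsepE[].
- by exists a0; apply/zsepE.
move=> /zsepE[km gm] mmin; exists m => //; apply: Cantor_Bernstein; last first.
  have gT a : a ∈ m -> exists u, g a = Some u.
    move=> ma; case E: (g a) => [u|]; first by exists u.
    have [|e|ma'] := mmin a; first by apply/zsepE; split=> //; exact: kT ma.
      by move: ma; rewrite e => /zin_irr.
    by have := zin_asym ma ma'.
  have [[a ma]|m0] := pselect (exists a, a ∈ m); last first.
    have -> : elts m = set0; last exact: card_ge0.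
    by rewrite predeqE => x; split=> // mx; case: m0; exists x.
  have [u0 _] := gT _ ma.
  apply: (@card_le_inj _ _ _ _ (fun x => odflt u0 (g x))) => [x kx|x y kx ky].
    by have [u gu] := gT _ kx; rewrite gu; have [] := gS _ _ gu.
  have [u gu] := gT _ kx; have [v gv] := gT _ ky; rewrite gu gv /= => uv.
  by apply: ginj (kT _ km _ kx) (kT _ km _ ky) gu _; rewrite uv.
pose h u := if pselect (exists2 b, R b m & g b = Some u) is left p
            then sval (cid2 p) else m.
apply: (@card_le_inj _ _ _ _ h) => [u Au|u v Au Av]; rewrite /h.
  case: pselect => [p|]; first by case: cid2 => b [].
  by case; exact: gN.
case: pselect => [p|[]]; last exact: gN.
case: pselect => [q|[]]; last exact: gN.
case: cid2 => b /= _ gb; case: cid2 => b' /= _ gb' e.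
by move: gb; rewrite e gb' => -[].
Qed.

Lemma card_nle mu a : is_cardinal mu -> a ∈ mu -> ~ (elts mu #<= elts a).
Proof.
move=> [muo mun] mua le; apply: (mun a mua).
by apply: Cantor_Bernstein le; exact: card_ord_sub.
Qed.

Lemma card_lt_le (T U : Type) (A : set T) (B : set U) mu : is_cardinal mu ->
  A #<= B -> card_lt B mu -> card_lt A mu.
Proof.
move=> muc AB [a mua /card_eqW[Ba _]].
have [le|//] := ord_compare A muc.1.
by have := card_nle muc mua (card_le_trans le (card_le_trans AB Ba)).
Qed.

(** The least ordinal equipotent with [a] is a cardinal below [mu]; by minimality of the successor
    it cannot lie above [lambda]. *)
Lemma succ_card_le lambda mu a : is_succ_cardinal lambda mu -> a ∈ mu ->
  elts a #<= elts lambda.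
Proof.
move=> [muc lm lmin] am.
have [muT [muirr mutr mutot mumin]] := muc.1.
have [||m /zsepE[mm ma] mmin] := mumin (zsep mu (fun b => elts b #= elts a)).
- by move=> z /zsepE[].
- by exists a; apply/zsepE; split=> //; exact: card_eqxx.
have mc : is_cardinal m.
  split=> [|c cm cEm]; first exact: ord_elt muc.1 mm.
  have [|e|h] := mmin c.
  - by apply/zsepE; split; [exact: muT cm|exact: card_eq_trans cEm ma].
  - by move: cm; rewrite e => /zin_irr.
  - by have := zin_asym cm h.
apply: (card_le_trans (card_eqW ma).2).
have [ml|->|lm'] := mutot _ _ mm lm; last 1 first.
- have [h|e] := lmin _ mc lm'; first by have := zin_asym mm h.
  by move: mm; rewrite e => /zin_irr.
- exact: card_ord_sub (ord_elt muc.1 lm) ml.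
- exact: card_lexx.
Qed.

Lemma card_lt_succ (U : Type) (A : set U) lambda mu : is_succ_cardinal lambda mu ->
  card_lt A mu <-> A #<= elts lambda.
Proof.
move=> sm; split=> [[a am /card_eqW[Aa _]]|le].
  exact: card_le_trans Aa (succ_card_le sm am).
case: sm => muc lm _; apply: (card_lt_le muc le).
by exists lambda => //; exact: card_eqxx.
Qed.

Definition zsucc x := zcup x (zupair x x).
Lemma zsuccE x z : z ∈ zsucc x <-> z ∈ x \/ z = x.
Proof. by rewrite zcupE zupairE; intuition. Qed.

Lemma zsucc_inj x y : zsucc x = zsucc y -> x = y.
Proof.
move=> e.
have /zsuccE[xy|//] : x ∈ zsucc y by rewrite -e; apply/zsuccE; right.
have /zsuccE[yx|//] : y ∈ zsucc x by rewrite e; apply/zsuccE; right.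
by have := zin_asym xy yx.
Qed.

Lemma ord_succ a b : is_ordinal a -> b ∈ a -> zsucc b ∈ a \/ a = zsucc b.
Proof.
move=> [aT [_ atr atot amin]] ab.
have [nb|noS] := pselect (exists c, c ∈ a /\ b ∈ c).
  have [||m /zsepE[am bm] mmin] := amin (zsep a (fun c => b ∈ c)).
  - by move=> z /zsepE[].
  - by have [c [ac bc]] := nb; exists c; apply/zsepE.
  left; suff -> : zsucc b = m by [].
  apply: zfc_extensionality => z; rewrite zsuccE; split=> [[zb|->//]|zm].
    by have az := aT _ ab _ zb; exact: (atr z b m).
  have az : z ∈ a by exact: aT zm.
  have [|->|bz] := atot _ _ az ab; auto.
  have [|e|h] := mmin z; first by apply/zsepE.
    by move: zm; rewrite e => /zin_irr.
  by have := zin_asym zm h.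
right; apply: zfc_extensionality => z; rewrite zsuccE; split=> [az|[zb|->//]].
  by have [|->|bz] := atot _ _ az ab; auto; case: noS; exists z.
exact: aT zb.
Qed.

Definition limit_ordinal a :=
  [/\ is_ordinal a, exists b, b ∈ a & forall b, b ∈ a -> zsucc b ∈ a].

Lemma limit_infinite a : limit_ordinal a -> infinite_set (elts a).
Proof.
move=> [ao [b ab] aS]; apply/infiniteP.
have incl n m : (n < m)%N -> iter n zsucc b ∈ iter m zsucc b.
  elim: m => // m IH; rewrite ltnS leq_eqVlt => /orP[/eqP->|/IH h] /=;
  by apply/zsuccE; auto.
apply: (@card_le_inj _ _ _ _ (fun n => iter n zsucc b)) => [n _|n m _ _ e].
  by elim: n => //= n; exact: aS.
by case: (ltngtP n m) => // /incl; rewrite e => /zin_irr.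
Qed.

Lemma infinite_cardinal_limit kappa : is_cardinal kappa ->
  infinite_set (elts kappa) -> limit_ordinal kappa.
Proof.
move=> kc kinf; split; first exact: kc.1.
  by have [x] := infinite_setN0 kinf; exists x.
move=> b kb; have [//|e] := ord_succ kc.1 kb.
case: (card_nle kc kb).
have binf : infinite_set (elts b).
  move=> bf; apply: kinf; have -> : elts kappa = elts b `|` [set b].
    by rewrite predeqE => z; rewrite /elts /= e zsuccE.
  by rewrite finite_setU.
have [g [gb ginj]] := card_le_injE b ((infiniteP _).1 binf).
(* Hilbert's hotel: if [kappa] were the successor of [b], moving each [g n] to [g n.+1] would free
   [g 0] for the extra point [b] and inject [kappa] into [b]. *)
pose h x := if pselect (exists n, x = g n) is left p then g (sval (cid p)).+1
            else if pselect (x = b) then g 0%N else x.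
have ngb n : g n <> b.
  by move=> gn; have := gb n I; rewrite gn => /zin_irr.
apply: (@card_le_inj _ _ _ _ h) => [x|x y]; rewrite /h.
  rewrite /elts /= {1}e => /zsuccE xb; case: pselect => [p|np]; first exact: gb.
  by case: pselect => [?|nx]; [exact: gb|case: xb].
move=> _ _; case: (pselect (exists n, x = g n)) => [p|np];
  case: (pselect (exists n, y = g n)) => [q|nq].
- case: (cid p) => n /= ->; case: (cid q) => m /= -> /ginj.
  by move=> /(_ I I)[->].
- case: (cid p) => n /= ->; case: pselect => [?|ny].
    by move=> ee; have := ginj _ _ I I ee.
  by move=> ey; case: nq; exists n.+1.
- case: (cid q) => n /= ->; case: pselect => [?|ny].
    by move=> ee; have := ginj _ _ I I ee.
  by move=> ey; case: np; exists n.+1.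
- case: pselect => [xb|nx]; case: pselect => [yb|ny] //= ee.
    by rewrite xb yb.
    by case: nq; exists 0%N.
  by case: np; exists 0%N.
Qed.

(* Every element of a limit ordinal is [iter n zsucc r] for a unique n and a
   unique r that is not a successor; doubling n leaves room for two copies. *)
Lemma card_le_setU (U : Type) (A B : set U) kappa : limit_ordinal kappa ->
  A #<= elts kappa -> B #<= elts kappa -> A `|` B #<= elts kappa.
Proof.
move=> [ko [k0 kk0] kS] Ak Bk.
pose root r := r ∈ kappa /\ forall y, y ∈ kappa -> r <> zsucc y.
have dec x : x ∈ kappa -> exists nr : nat * V, root nr.2 /\ x = iter nr.1 zsucc nr.2.
  elim/(well_founded_ind (ord_wf ko)): x => x IH kx.
  have [[y [ky e]]|nS] := pselect (exists y, y ∈ kappa /\ x = zsucc y).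
    have yx : y ∈ x by rewrite e; apply/zsuccE; right.
    have [//|[n r] [/= rr ye]] := IH y _ ky.
    by exists (n.+1, r); split=> //=; rewrite e ye.
  by exists (0%N, x); split=> //; split=> // y ky e; apply: nS; exists y.
have iterk n r : r ∈ kappa -> iter n zsucc r ∈ kappa.
  by move=> kr; elim: n => //= n; exact: kS.
have uniq n m r r' : root r -> root r' -> iter n zsucc r = iter m zsucc r' ->
    n = m /\ r = r'.
  move=> [kr nr] [kr' nr']; elim: n m => [|n IH] [|m] //=.
  - by move=> e; case: (nr _ (iterk m r' kr')).
  - by move=> e; case: (nr' _ (iterk n r kr)).
  - by move=> /zsucc_inj /IH[-> ->].
pose d x : nat * V := if pselect (x ∈ kappa) is left p then sval (cid (dec x p))
                      else (0%N, x).
have dP x : x ∈ kappa -> root (d x).2 /\ x = iter (d x).1 zsucc (d x).2.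
  by rewrite /d; case: pselect => // p _; case: cid.
pose h (i : bool) x := iter (i + (d x).1.*2) zsucc (d x).2.
have hk i x : x ∈ kappa -> h i x ∈ kappa by move=> /dP[[kr _] _]; exact: iterk.
have hinj i i' x x' : x ∈ kappa -> x' ∈ kappa -> h i x = h i' x' -> i = i' /\ x = x'.
  move=> /dP[rx ex] /dP[rx' ex'] /uniq[] // e er.
  have ei : i = i'.
    by have := congr1 odd e; rewrite !oddD !odd_double !addbF !oddb.
  move: e; rewrite ei => /addnI /double_inj e.
  by split=> //; rewrite ex ex' e er.
have [f [fk finj]] := card_le_injE k0 Ak.
have [g [gk ginj]] := card_le_injE k0 Bk.
apply: (@card_le_inj _ _ _ _ (fun u =>
  if pselect (A u) then h false (f u) else h true (g u))).
  by move=> u ABu; case: pselect => Au; apply: hk; [exact: fk|case: ABu => // /gk].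
move=> u v ABu ABv; case: pselect => Au; case: pselect => Av.
- by move=> /hinj[||_ /finj]; try exact: fk; exact.
- by case: ABv => // /[dup] Bv /gk gv /hinj[||//]; [exact: fk|exact: gv].
- by case: ABu => // /[dup] Bu /gk gu /hinj[||//]; [exact: gu|exact: fk].
- case: ABv => // Bv; case: ABu => // Bu.
  by move=> /hinj[||_ /ginj]; try exact: gk; exact.
Qed.

Lemma card_le_set1 (U : Type) (u : U) x y : y ∈ x -> [set u] #<= elts x.
Proof.
by move=> xy; apply: (@card_le_inj _ _ _ _ (fun=> y)) => [|? ? -> ->].
Qed.

(** * The sets H(mu) *)

(** Any small transitive set including [x] will do, because the transitive closure can be carved out
    of it by separation. *)
Lemma in_H_sub mu x t : is_cardinal mu -> transitive_set t -> x ⊆ t ->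
  card_lt (elts t) mu -> in_H mu x.
Proof.
move=> muc tT xt tmu.
pose u := zsep t (fun z => forall s, transitive_set s -> x ⊆ s -> z ∈ s).
exists u; last first.
  by apply: card_lt_le muc _ tmu; apply: subset_card_le => z /zsepE[].
split.
- move=> y /zsepE[ty yP] z zy; apply/zsepE; split; first exact: tT zy.
  by move=> s sT xs; apply: (sT y) => //; exact: yP.
- by move=> z xz; apply/zsepE; split; [exact: xt|move=> s _; exact].
- by move=> s sT xs z /zsepE[_]; exact.
Qed.

Lemma in_H_elt mu x y : is_cardinal mu -> in_H mu y -> x ∈ y -> in_H mu x.
Proof.
by move=> muc [t [tT yt _] tmu] xy; apply: (in_H_sub muc tT _ tmu); exact/tT/yt.
Qed.

Lemma in_H_subset mu x y : is_cardinal mu -> in_H mu y -> x ⊆ y -> in_H mu x.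
Proof.
by move=> muc [t [tT yt _] tmu] xy; apply: (in_H_sub muc tT _ tmu) => z /xy /yt.
Qed.

Lemma in_H_lt mu a : is_cardinal mu -> a ∈ mu -> in_H mu a.
Proof.
move=> muc ma; apply: (@in_H_sub _ _ a) => //; last by exists a => //; exact: card_eqxx.
by have [] := ord_elt muc.1 ma.
Qed.

Lemma in_H_zupair lambda mu x y : is_succ_cardinal lambda mu ->
  limit_ordinal lambda -> in_H mu x -> in_H mu y -> in_H mu (zupair x y).
Proof.
move=> sm ll [t [tT xt _] tmu] [s [sT ys _] smu].
have muc : is_cardinal mu by case: sm.
pose w := zcup (zcup t s) (zupair x y).
have wP z : z ∈ w <-> (z ∈ t \/ z ∈ s) \/ (z = x \/ z = y).
  by rewrite !zcupE zupairE.
apply: (@in_H_sub _ _ w) => //.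
- move=> z /wP[[zt|zs]|[->|->]] u uz; apply/wP; left.
  + by left; exact: tT uz.
  + by right; exact: sT uz.
  + by left; exact: xt.
  + by right; exact: ys.
- by move=> z /zupairE h; apply/wP; right.
apply/(card_lt_succ _ sm).
have -> : elts w = (elts t `|` elts s) `|` ([set x] `|` [set y]).
  by rewrite predeqE => z; exact: wP.
move/(card_lt_succ _ sm): tmu => tl; move/(card_lt_succ _ sm): smu => sl.
have [_ [k0 kk0] _] := ll.
by do 2?apply: card_le_setU => //; exact: card_le_set1 kk0.
Qed.

Lemma in_H_ztriple lambda mu x y z : is_succ_cardinal lambda mu ->
  limit_ordinal lambda -> in_H mu x -> in_H mu y -> in_H mu z ->
  in_H mu (ztriple x y z).
Proof.
move=> sm ll hx hy hz.
by do ![exact: hx | exact: hy | exact: hz | apply: (in_H_zupair sm ll)].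
Qed.

End SetTheory.

(** * Formulas *)

Section Formulas.
Variable P : Type.
Implicit Type n : nat.

Definition fNot n (f : form P n) : form P n := FImp f (FFalse P n).
Definition fAnd n (f g : form P n) : form P n := fNot (FImp f (fNot g)).
Definition fOr n (f g : form P n) : form P n := FImp (fNot f) g.
Definition fIff n (f g : form P n) : form P n := fAnd (FImp f g) (FImp g f).
Definition fEx n (f : form P n.+1) : form P n := fNot (FAll (fNot f)).

Definition shift n (i : var n) : var n.+1 := Some i.
Definition v0 n : var n.+1 := None.
Definition v1 n : var n.+2 := shift (v0 n).
Definition v2 n : var n.+3 := shift (v1 n).

Definition fSub n (x y : var n) : form P n :=
  FAll (FImp (FMem P (v0 n) (shift x)) (FMem P (v0 n) (shift y))).

Definition fEmpty n (x : var n) : form P n := FAll (fNot (FMem P (v0 n) (shift x))).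

Definition fSucc n (y x : var n) : form P n :=
  FAll (fIff (FMem P (v0 n) (shift y))
             (fOr (FMem P (v0 n) (shift x)) (FEq P (v0 n) (shift x)))).

Definition fUpair n (z x y : var n) : form P n :=
  FAll (fIff (FMem P (v0 n) (shift z))
             (fOr (FEq P (v0 n) (shift x)) (FEq P (v0 n) (shift y)))).

Definition fPair n (z x y : var n) : form P n :=
  fEx (fEx (fAnd (fUpair (v1 n) (shift (shift x)) (shift (shift x)))
           (fAnd (fUpair (v0 n.+1) (shift (shift x)) (shift (shift y)))
                 (fUpair (shift (shift z)) (v1 n) (v0 n.+1))))).

Variable p : P.

Definition fTriple n (x y z : var n) : form P n :=
  fEx (fAnd (fPair (v0 n) (shift y) (shift z))
      (fEx (fAnd (fPair (v0 n.+1) (shift (shift x)) (v1 n))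
                 (FPred p (v0 n.+1))))).

Definition fE n (D a d : var n) : form P n :=
  fAnd (fTriple D a d) (fNot (FEq P D d)).

Definition fF n (x : var n) : form P n := fTriple x x x.

(** A sentence has no parameters, so lambda must be defined inside the structure: it is the largest
    member of the filter. *)
Definition fTop n (l : var n) : form P n :=
  fAnd (fF l) (FAll (FImp (fF (v0 n)) (fSub (v0 n) (shift l)))).

Definition fCompl n (l x y : var n) : form P n :=
  fAnd (fSub x l)
    (FAll (fIff (FMem P (v0 n) (shift y))
       (fAnd (FMem P (v0 n) (shift l)) (fNot (FMem P (v0 n) (shift x)))))).

Definition fInter n (l D z : var n) : form P n :=
  FAll (fIff (FMem P (v0 n) (shift z))
    (fAnd (FMem P (v0 n) (shift l))
      (FAll (FAll (FImp (fE (shift (shift (shift D))) (v1 n.+1) (v0 n.+2))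
                        (FMem P (v2 n) (v0 n.+2))))))).

Definition fBoundAt n (D g : var n) : form P n :=
  FAll (FAll (FImp (fE (shift (shift D)) (v1 n) (v0 n.+1))
                   (FMem P (v1 n) (shift (shift g))))).

Definition fBound n (r D : var n) : form P n :=
  fEx (fAnd (FMem P (v0 n) (shift r)) (fBoundAt (shift D) (v0 n))).

End Formulas.

Section Connectives.
Variables (M : Type) (E : M -> M -> Prop) (P : Type) (I : P -> M -> Prop).
Variables (n : nat) (v : var n -> M).

Lemma sat_fAnd (f g : form P n) : sat E I (fAnd f g) v <-> sat E I f v /\ sat E I g v.
Proof.
split=> /= [h|[hf hg] h]; last exact: h.
by split; apply: contrapT => nh; apply: h => ? ?.
Qed.

Lemma sat_fOr (f g : form P n) : sat E I (fOr f g) v <-> sat E I f v \/ sat E I g v.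
Proof.
split=> /= [h|[hf|hg] h] //.
by have [|/h] := pselect (sat E I f v); auto.
Qed.

Lemma sat_fIff (f g : form P n) :
  sat E I (fIff f g) v <-> (sat E I f v <-> sat E I g v).
Proof. by rewrite sat_fAnd. Qed.

Lemma sat_fImp (f g : form P n) :
  sat E I (FImp f g) v <-> (sat E I f v -> sat E I g v).
Proof. by []. Qed.

Lemma sat_fAll (f : form P n.+1) :
  sat E I (FAll f) v <-> forall x, sat E I f (env_cons x v).
Proof. by []. Qed.

Lemma sat_fEx (f : form P n.+1) :
  sat E I (fEx f) v <-> exists x, sat E I f (env_cons x v).
Proof.
split=> /= [h|[x hx] h]; last exact: (h x).
by apply: contrapT => nh; apply: h => x hx; apply: nh; exists x.
Qed.

End Connectives.

(** * Truth in H(mu), uniformly for the languages of elementarity and of Pi^1_1 sentences *)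

Section Semantics.
Variable V : zfcUniverse.

(* A set A codes a ternary relation through [ztriple]. The triples (x, x, x) list
   the members x of a filter; a triple (D, a, d) with D <> d says that d is the
   member number a of the family with index D. *)
Definition relF (A x : V) := ztriple x x x ∈ A.
Definition relE (A D a d : V) := ztriple D a d ∈ A /\ D <> d.
Definition isTop (A l : V) := relF A l /\ forall x, relF A x -> x ⊆ l.
Definition isCompl (l x y : V) := x ⊆ l /\ forall b, b ∈ y <-> b ∈ l /\ ~ b ∈ x.
Definition isInter (A l D z : V) :=
  forall b, b ∈ z <-> b ∈ l /\ forall a d, relE A D a d -> b ∈ d.
Definition bounded (A D g : V) := forall a d, relE A D a d -> a ∈ g.

Variables (mu : V) (muc : is_cardinal mu).
Local Notation E := (@H_mem V mu).

Lemma H_eq (x y : H mu) : sval x = sval y -> x = y.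
Proof.
by case: x y => [x px] [y py] /= e; subst y; congr exist; exact: Prop_irrelevance.
Qed.

Lemma H_eqE (x y : H mu) : x = y <-> sval x = sval y.
Proof. by split=> [->//|/H_eq]. Qed.

(** Transitivity of H(mu), the source of the absoluteness of the formulas below. *)
Lemma H_elt (x : H mu) y : y ∈ sval x -> exists y' : H mu, sval y' = y.
Proof. by move=> yx; exists (exist _ y (in_H_elt muc (svalP x) yx)). Qed.

Lemma H_forall_mem (x : H mu) (Q : V -> Prop) :
  (forall y : H mu, sval y ∈ sval x -> Q (sval y)) -> forall y, y ∈ sval x -> Q y.
Proof. by move=> h y /[dup] yx /H_elt[y' ey]; rewrite -ey; apply: h; rewrite ey. Qed.

Variables (P : Type) (I : P -> H mu -> Prop).

Lemma sat_fSub n (v : var n -> H mu) x y :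
  sat E I (fSub P x y) v <-> sval (v x) ⊆ sval (v y).
Proof.
split=> [h|h z] /=; last exact: h.
exact: (@H_forall_mem (v x) (fun z => z ∈ sval (v y))).
Qed.

Lemma sat_fEmpty n (v : var n -> H mu) x :
  sat E I (fEmpty P x) v <-> forall y, ~ y ∈ sval (v x).
Proof.
split=> [h y yx|h y]; last exact: h.
by have [y' e] := H_elt yx; apply: (h y'); rewrite /= /H_mem e.
Qed.

Lemma sat_fSucc n (v : var n -> H mu) y x :
  sat E I (fSucc P y x) v <-> sval (v y) = zsucc (sval (v x)).
Proof.
rewrite sat_fAll; split=> [h|h z]; last first.
  by rewrite sat_fIff sat_fOr /= /H_mem H_eqE h zsuccE.
have {}h (z : H mu) : sval z ∈ sval (v y) <->
    sval z ∈ sval (v x) \/ sval z = sval (v x).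
  by have := h z; rewrite sat_fIff sat_fOr /= /H_mem H_eqE.
apply: zfc_extensionality => z; rewrite zsuccE; split=> [/[dup] zy /H_elt[z' e]|].
  by rewrite -e; apply/h; rewrite e.
case=> [/[dup] zx /H_elt[z' e]|->]; last by apply/h; right.
by rewrite -e; apply/h; rewrite e; left.
Qed.

Lemma sat_fUpair n (v : var n -> H mu) z x y :
  sat E I (fUpair P z x y) v <-> sval (v z) = zupair (sval (v x)) (sval (v y)).
Proof.
rewrite sat_fAll; split=> [h|h u]; last first.
  by rewrite sat_fIff sat_fOr /= /H_mem !H_eqE h zupairE.
have {}h (u : H mu) : sval u ∈ sval (v z) <->
    sval u = sval (v x) \/ sval u = sval (v y).
  by have := h u; rewrite sat_fIff sat_fOr /= /H_mem !H_eqE.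
apply: zfc_extensionality => u; rewrite zupairE; split=> [/[dup] uz /H_elt[u' e]|].
  by rewrite -e; apply/h; rewrite e.
by case=> ->; apply/h; auto.
Qed.

Lemma sat_fPair n (v : var n -> H mu) z x y :
  sat E I (fPair P z x y) v <-> sval (v z) = zpair (sval (v x)) (sval (v y)).
Proof.
rewrite sat_fEx; split.
  move=> [s /sat_fEx[t /sat_fAnd[/sat_fUpair es /sat_fAnd[/sat_fUpair et /sat_fUpair ez]]]].
  by move: es et ez => /= es et ->; rewrite es et.
move=> e.
(* The inner pairs are elements of [v z], hence in H(mu). Closure under pairing is not at hand for
   H(mubar), where mubar is only known to be a cardinal. *)
have [s es] : exists s : H mu, sval s = zupair (sval (v x)) (sval (v x)).
  by apply: (H_elt (x := v z)); rewrite e; apply/zupairE; left.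
have [t et] : exists s : H mu, sval s = zupair (sval (v x)) (sval (v y)).
  by apply: (H_elt (x := v z)); rewrite e; apply/zupairE; right.
exists s; apply/sat_fEx; exists t.
by rewrite !sat_fAnd !sat_fUpair /= es et.
Qed.

Lemma H_zpair x y : in_H mu (zpair x y) -> in_H mu x /\ in_H mu y.
Proof.
move=> h; have h' : in_H mu (zupair x y).
  by apply: in_H_elt muc h _; apply/zupairE; right.
by split; apply: in_H_elt muc h' _; apply/zupairE; auto.
Qed.

Variables (p : P) (A : V).
Hypotheses (AH : subset_of_H mu A) (IA : forall x, I p x = (sval x ∈ A)).

(** The witnesses required by [fTriple] exist in H(mu): a triple in [A] belongs to H(mu) by [AH],
    and so does the pair inside it. *)
Lemma sat_fTriple n (v : var n -> H mu) x y z : sat E I (fTriple p x y z) v <->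
  ztriple (sval (v x)) (sval (v y)) (sval (v z)) ∈ A.
Proof.
rewrite sat_fEx; split.
  move=> [s /sat_fAnd[/sat_fPair es /sat_fEx[t /sat_fAnd[/sat_fPair et]]]].
  by move: es et => /= es et; rewrite IA et es.
move=> /[dup] h /AH /[dup] ht /H_zpair[_ hs].
exists (exist _ _ hs); rewrite sat_fAnd sat_fPair; split=> //.
by apply/sat_fEx; exists (exist _ _ ht); rewrite sat_fAnd sat_fPair /= IA.
Qed.

Lemma relE_H D a d : relE A D a d -> [/\ in_H mu D, in_H mu a & in_H mu d].
Proof. by move=> [/AH /H_zpair[? /H_zpair[]]]. Qed.

Lemma relF_H x : relF A x -> in_H mu x.
Proof. by move=> /AH /H_zpair[]. Qed.

Lemma sat_fE n (v : var n -> H mu) D a d :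
  sat E I (fE p D a d) v <-> relE A (sval (v D)) (sval (v a)) (sval (v d)).
Proof. by rewrite sat_fAnd sat_fTriple /= H_eqE. Qed.

Lemma sat_fF n (v : var n -> H mu) x : sat E I (fF p x) v <-> relF A (sval (v x)).
Proof. exact: sat_fTriple. Qed.

Lemma sat_fTop n (v : var n -> H mu) l : sat E I (fTop p l) v <-> isTop A (sval (v l)).
Proof.
rewrite sat_fAnd sat_fAll sat_fF /isTop; split=> -[Fl h]; split=> // x.
  move=> Fx; have := h (exist _ x (relF_H Fx)).
  by rewrite sat_fImp sat_fF sat_fSub /=; exact.
by rewrite sat_fImp sat_fF sat_fSub; exact: h.
Qed.

Lemma sat_fCompl n (v : var n -> H mu) l x y :
  sat E I (fCompl P l x y) v <-> isCompl (sval (v l)) (sval (v x)) (sval (v y)).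
Proof.
rewrite sat_fAnd sat_fAll sat_fSub /isCompl; split=> -[xl h]; split=> // b; last first.
  by rewrite sat_fIff sat_fAnd; exact: h.
have {}h (c : H mu) : sval c ∈ sval (v y) <->
    sval c ∈ sval (v l) /\ ~ sval c ∈ sval (v x).
  by have := h c; rewrite sat_fIff sat_fAnd.
by split=> [h1|[h1 h2]]; have [b' e] := H_elt h1; rewrite -e; apply/h; rewrite e.
Qed.

Lemma sat_fEall n (v : var n -> H mu) (D : var n) (f : form P n.+2) (Q : V -> V -> Prop) :
  (forall a d : H mu, sat E I f (env_cons d (env_cons a v)) <-> Q (sval a) (sval d)) ->
  sat E I (FAll (FAll (FImp (fE p (shift (shift D)) (v1 n) (v0 n.+1)) f))) v <->
  forall a d, relE A (sval (v D)) a d -> Q a d.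
Proof.
move=> fQ; split=> [h a d /[dup] Ead /relE_H[_ Ha Hd]|h a d]; last first.
  by move=> /sat_fE Ead; apply/fQ; exact: h.
by apply/(fQ (exist _ a Ha) (exist _ d Hd))/h; apply/sat_fE.
Qed.

Lemma sat_fInter n (v : var n -> H mu) l D z : sat E I (fInter p l D z) v <->
  isInter A (sval (v l)) (sval (v D)) (sval (v z)).
Proof.
have aux (b : H mu) : sat E I (FAll (FAll (FImp (fE p (shift (shift (shift D)))
      (v1 n.+1) (v0 n.+2)) (FMem P (v2 n) (v0 n.+2))))) (env_cons b v) <->
    forall a d, relE A (sval (v D)) a d -> sval b ∈ d.
  exact: (@sat_fEall _ _ _ _ (fun a d => sval b ∈ d)).
rewrite sat_fAll; split=> h b; last by rewrite sat_fIff sat_fAnd aux; exact: h.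
have {}h (c : H mu) : sval c ∈ sval (v z) <-> sval c ∈ sval (v l) /\
    forall a d, relE A (sval (v D)) a d -> sval c ∈ d.
  by have := h c; rewrite sat_fIff sat_fAnd aux.
by split=> [h1|[h1 h2]]; have [b' e] := H_elt h1; rewrite -e; apply/h; rewrite e.
Qed.

Lemma sat_fBoundAt n (v : var n -> H mu) D g : sat E I (fBoundAt p D g) v <->
  bounded A (sval (v D)) (sval (v g)).
Proof. exact: (@sat_fEall _ _ _ _ (fun a d => a ∈ sval (v g))). Qed.

Lemma sat_fBound n (v : var n -> H mu) r D : sat E I (fBound p r D) v <->
  exists2 g, g ∈ sval (v r) & bounded A (sval (v D)) g.
Proof.
rewrite sat_fEx; split=> [[g /sat_fAnd[gr /sat_fBoundAt h]]|].
  by exists (sval g).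
move=> [g /[dup] gr /H_elt[g' e] h].
by exists g'; rewrite sat_fAnd sat_fBoundAt /= /H_mem e.
Qed.

End Semantics.

(** * Elementary embeddings *)

Section Transfer.
Variables (V : zfcUniverse) (mubar mu B A : V).
Hypotheses (mbc : is_cardinal mubar) (muc : is_cardinal mu).
Hypotheses (BH : subset_of_H mubar B) (AH : subset_of_H mu A).
Variables (j : H mubar -> H mu) (jel : elementary B A j).
Implicit Types (x y z l D : H mubar).

Local Notation nilB := (@env_nil (H mubar)).

Lemma j_mem x y : sval x ∈ sval y <-> sval (j x) ∈ sval (j y).
Proof. exact: (jel (FMem unit (v0 1) (v1 0)) (env_cons x (env_cons y nilB))). Qed.

Lemma j_sub x y : sval x ⊆ sval y <-> sval (j x) ⊆ sval (j y).
Proof.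
have := jel (fSub unit (v0 1) (v1 0)) (env_cons x (env_cons y nilB)).
by rewrite (sat_fSub mbc) (sat_fSub muc).
Qed.

Lemma j_empty x : (forall u, ~ u ∈ sval x) <-> (forall u, ~ u ∈ sval (j x)).
Proof.
have := jel (fEmpty unit (v0 0)) (env_cons x nilB).
by rewrite (sat_fEmpty mbc) (sat_fEmpty muc).
Qed.

Lemma j_succ y x : sval y = zsucc (sval x) <-> sval (j y) = zsucc (sval (j x)).
Proof.
have := jel (fSucc unit (v0 1) (v1 0)) (env_cons y (env_cons x nilB)).
by rewrite (sat_fSucc mbc) (sat_fSucc muc).
Qed.

Let satB := @sat_fTriple V mubar mbc unit (@pred1_interp V mubar B) tt B BH (fun=> erefl).
Let satA := @sat_fTriple V mu muc unit (@pred1_interp V mu A) tt A AH (fun=> erefl).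
Let satEB := @sat_fE V mubar mbc unit (@pred1_interp V mubar B) tt B BH (fun=> erefl).
Let satEA := @sat_fE V mu muc unit (@pred1_interp V mu A) tt A AH (fun=> erefl).

Lemma j_triple x y z : ztriple (sval x) (sval y) (sval z) ∈ B <->
  ztriple (sval (j x)) (sval (j y)) (sval (j z)) ∈ A.
Proof.
have := jel (fTriple tt (v0 2) (v1 1) (v2 0)) (env_cons x (env_cons y (env_cons z nilB))).
by rewrite satB satA.
Qed.

Lemma j_relE D x y : relE B (sval D) (sval x) (sval y) <->
  relE A (sval (j D)) (sval (j x)) (sval (j y)).
Proof.
have := jel (fE tt (v0 2) (v1 1) (v2 0)) (env_cons D (env_cons x (env_cons y nilB))).
by rewrite satEB satEA.
Qed.

(** An element of H(mu) need not be in the range of [j]. The [j_ex_] lemmas produce elements that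
    are, by reflecting an existential statement whose parameters, if any, are images. *)
Lemma j_ex_triple (x y z : H mu) : ztriple (sval x) (sval y) (sval z) ∈ A ->
  exists x' y' z', ztriple (sval x') (sval y') (sval z') ∈ B.
Proof.
move=> h.
have /sat_fEx[x' /sat_fEx[y' /sat_fEx[z' /satB h']]] :
    sat (@H_mem V mubar) (pred1_interp B)
        (fEx (fEx (fEx (fTriple tt (v2 0) (v1 1) (v0 2))))) nilB.
  apply/jel/sat_fEx; exists x; apply/sat_fEx; exists y; apply/sat_fEx; exists z.
  exact/satA.
by exists x', y', z'.
Qed.

Lemma j_ex_triple2 x z (y : H mu) : ztriple (sval (j x)) (sval y) (sval (j z)) ∈ A ->
  exists y', ztriple (sval x) (sval y') (sval z) ∈ B.
Proof.
move=> h.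
have /sat_fEx[y' /satB h'] : sat (@H_mem V mubar) (pred1_interp B)
    (fEx (fTriple tt (v1 1) (v0 2) (v2 0))) (env_cons x (env_cons z nilB)).
  by apply/jel/sat_fEx; exists y; exact/satA.
by exists y'.
Qed.

Lemma j_ex_relE D x (d : H mu) : relE A (sval (j D)) (sval (j x)) (sval d) ->
  exists d' : H mubar, relE B (sval D) (sval x) (sval d').
Proof.
move=> h.
have /sat_fEx[d' /satEB h'] : sat (@H_mem V mubar) (pred1_interp B)
    (fEx (fE tt (v1 1) (v2 0) (v0 2))) (env_cons D (env_cons x nilB)).
  by apply/jel/sat_fEx; exists d; exact/satEA.
by exists d'.
Qed.

Lemma j_top l : isTop B (sval l) <-> isTop A (sval (j l)).
Proof.
have := jel (fTop tt (v0 0)) (env_cons l nilB).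
by rewrite (sat_fTop mbc BH (fun=> erefl)) (sat_fTop muc AH (fun=> erefl)).
Qed.

Lemma j_ex_top (l : H mu) : isTop A (sval l) -> exists l' : H mubar, isTop B (sval l').
Proof.
move=> h.
have /sat_fEx[l' /(sat_fTop mbc BH (fun=> erefl)) h'] :
    sat (@H_mem V mubar) (pred1_interp B) (fEx (fTop tt (v0 0))) nilB.
  by apply/jel/sat_fEx; exists l; exact/(sat_fTop muc AH (fun=> erefl)).
by exists l'.
Qed.

Lemma j_compl l x y : isCompl (sval l) (sval x) (sval y) <->
  isCompl (sval (j l)) (sval (j x)) (sval (j y)).
Proof.
have := jel (fCompl unit (v0 2) (v1 1) (v2 0)) (env_cons l (env_cons x (env_cons y nilB))).
by rewrite (sat_fCompl mbc) (sat_fCompl muc).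
Qed.

Lemma j_inter l D z : isInter B (sval l) (sval D) (sval z) <->
  isInter A (sval (j l)) (sval (j D)) (sval (j z)).
Proof.
have := jel (fInter tt (v0 2) (v1 1) (v2 0)) (env_cons l (env_cons D (env_cons z nilB))).
by rewrite (sat_fInter mbc BH (fun=> erefl)) (sat_fInter muc AH (fun=> erefl)).
Qed.

Lemma j_bounded (r : H mubar) D : (exists2 g, g ∈ sval r & bounded B (sval D) g) <->
  (exists2 g, g ∈ sval (j r) & bounded A (sval (j D)) g).
Proof.
have := jel (fBound tt (v0 1) (v1 0)) (env_cons r (env_cons D nilB)).
by rewrite (sat_fBound mbc BH (fun=> erefl)) (sat_fBound muc AH (fun=> erefl)).
Qed.

Lemma j_bounded_at D (g : H mubar) : bounded B (sval D) (sval g) <->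
  bounded A (sval (j D)) (sval (j g)).
Proof.
have := jel (fBoundAt tt (v0 1) (v1 0)) (env_cons D (env_cons g nilB)).
by rewrite (sat_fBoundAt mbc BH (fun=> erefl)) (sat_fBoundAt muc AH (fun=> erefl)).
Qed.

End Transfer.

(** * The Pi^1_1 sentence *)

(* The models of [fGood] are the pairs (A, X) such that X is an ultrafilter on
   the largest element of the filter coded in A, extends that filter, and is
   closed under the intersections coded in A. *)
Definition fGood : form bool 0 :=
  FAll (FImp (fTop false (v0 0))
    (fAnd (FAll (FImp (fF false (v0 1)) (FPred true (v0 1))))
    (fAnd (FAll (FAll (FImp (fCompl bool (v2 0) (v1 1) (v0 2))
             (fIff (FPred true (v1 1)) (fNot (FPred true (v0 2)))))))
          (FAll (FAll (FImp
             (FAll (FAll (FImp (fE false (shift (shift (v1 1))) (v1 3) (v0 4))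
                               (FPred true (v0 4)))))
             (FImp (fInter false (v2 0) (v1 1) (v0 2)) (FPred true (v0 2))))))))).

Definition good (V : zfcUniverse) (mu A X : V) := forall l, isTop A l ->
  [/\ forall x, relF A x -> x ∈ X,
      forall x y, in_H mu x -> in_H mu y -> isCompl l x y -> (x ∈ X <-> ~ y ∈ X) &
      forall D z, in_H mu D -> in_H mu z ->
        (forall a d, relE A D a d -> d ∈ X) -> isInter A l D z -> z ∈ X].

Lemma sat_fGood (V : zfcUniverse) (mu A X : V) : is_cardinal mu ->
  subset_of_H mu A ->
  sat (@H_mem V mu) (@pred2_interp V mu A X) fGood (@env_nil (H mu)) <-> good mu A X.
Proof.
move=> muc AH.
have IA (x : H mu) : pred2_interp A X false x = (sval x ∈ A) by [].
have aux n (v : var n -> H mu) (D : var n) :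
    sat (@H_mem V mu) (@pred2_interp V mu A X)
      (FAll (FAll (FImp (fE false (shift (shift D)) (v1 n) (v0 n.+1))
                        (FPred true (v0 n.+1))))) v <->
    forall a d, relE A (sval (v D)) a d -> d ∈ X.
  exact: (sat_fEall muc AH IA).
rewrite sat_fAll; split=> [h l tl|h l].
  have Hl := relF_H muc AH tl.1.
  have := h (exist _ l Hl); rewrite sat_fImp (sat_fTop muc AH IA) => /(_ tl).
  move=> /sat_fAnd[/sat_fAll h1 /sat_fAnd[/sat_fAll h2 /sat_fAll h3]]; split.
  - move=> x Fx; have := h1 (exist _ x (relF_H muc AH Fx)).
    by rewrite sat_fImp (sat_fF muc AH IA); exact.
  - move=> x y Hx Hy; have /sat_fAll/(_ (exist _ y Hy)) := h2 (exist _ x Hx).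
    by rewrite sat_fImp (sat_fCompl muc) sat_fIff.
  - move=> D z HD Hz; have /sat_fAll/(_ (exist _ z Hz)) := h3 (exist _ D HD).
    by rewrite !sat_fImp aux (sat_fInter muc AH IA).
rewrite sat_fImp (sat_fTop muc AH IA) => tl; have [h1 h2 h3] := h _ tl.
apply/sat_fAnd; split; last (apply/sat_fAnd; split).
- by apply/sat_fAll => x; rewrite sat_fImp (sat_fF muc AH IA); exact: h1.
- apply/sat_fAll => x; apply/sat_fAll => y; rewrite sat_fImp (sat_fCompl muc) sat_fIff.
  by apply: h2; exact: svalP.
- apply/sat_fAll => D; apply/sat_fAll => z; rewrite !sat_fImp aux (sat_fInter muc AH IA).
  by apply: h3; exact: svalP.
Qed.

(** * Ultrafilters and codes of families of sets *)

(** Upward closure comes from deciding every set: if [S] is in [U] and a superset [S'] is not, then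
    the complement of [S'] is, and so is its empty intersection with [S]. *)
Lemma ultrafilter_decide (T : Type) (U : set_system T) : U setT ->
  (forall S, U S <-> ~ U (~` S)) -> (forall S S', U S -> U S' -> U (S `&` S')) ->
  UltraFilter U.
Proof.
move=> UT UC UI.
have U0 : ~ U set0 by rewrite -setCT; exact: (UC setT).1 UT.
have UP : ProperFilter U.
  split=> //; split=> // S S' SS' US; apply/UC => /(UI _ _ US).
  suff -> : S `&` ~` S' = set0 by [].
  by rewrite predeqE => x; split=> // -[/SS'].
split=> // G GP UG; rewrite predeqE => S; split=> [GS|]; last exact: UG.
apply/UC => /UG GS'; apply: (@filter_not_empty _ G GP).
by rewrite -(setICr S); exact: filterI.
Qed.

Section Coding.
Variables (V : zfcUniverse) (lambda : V).
Local Notation T := {x : V | x ∈ lambda}.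

Definition code (S : set T) : V := zsep lambda (fun x => exists2 t, S t & sval t = x).

Lemma codeE S (t : T) : sval t ∈ code S <-> S t.
Proof.
split=> [/zsepE[_ [t' St' e]]|St]; last first.
  by apply/zsepE; split; [exact: (svalP t)|exists t].
suff <- : t' = t by [].
by case: t' t e {St'} => [x px] [y py] /= e; subst y; congr exist; exact: Prop_irrelevance.
Qed.

Lemma code_elt S x : x ∈ code S -> exists2 t, S t & sval t = x.
Proof. by move=> /zsepE[]. Qed.

Lemma code_sub S : code S ⊆ lambda.
Proof. by move=> x /zsepE[]. Qed.

Lemma code_inj : injective code.
Proof. by move=> S S' e; rewrite predeqE => t; rewrite -!codeE e. Qed.

Lemma codeT : code setT = lambda.
Proof.
apply: zfc_extensionality => z; split=> [/code_sub//|zl].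
exact: ((codeE setT (exist _ z zl)).2 I).
Qed.

Lemma code_compl S : isCompl lambda (code S) (code (~` S)).
Proof.
split=> [|x]; first exact: code_sub.
split=> [/code_elt[t nSt <-]|[xl]]; first by split; [exact: (svalP t)|move=> /codeE].
by have := codeE S (exist _ x xl); have := codeE (~` S) (exist _ x xl) => /= -> ->.
Qed.

Definition codes (D : set (set T)) : V := zsep (zpow lambda) [set y | (code @` D) y].

Lemma codesE D S : code S ∈ codes D <-> D S.
Proof.
split=> [/zsepE[_ [S' DS' /code_inj <-]]//|DS].
by apply/zsepE; split; [apply/zpowE; exact: code_sub|exists S].
Qed.

Lemma codes_inj : injective codes.
Proof. by move=> D D' e; rewrite predeqE => S; rewrite -!codesE e. Qed.

Lemma elts_codes D : elts (codes D) = code @` D.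
Proof.
rewrite predeqE => y; split=> [/zsepE[]//|Dy]; apply/zsepE; split=> //.
by case: Dy => S _ <-; apply/zpowE; exact: code_sub.
Qed.

Lemma codes_in_H mu D : is_succ_cardinal lambda mu -> limit_ordinal lambda ->
  D #<= elts lambda -> in_H mu (codes D).
Proof.
move=> sm ll Dl; have [muc _ _] := sm; have [[lT _] _ _] := ll.
(* Elements of [codes D] are subsets of [lambda], so adjoining [lambda] makes the set transitive. *)
apply: (@in_H_sub _ _ _ (zcup lambda (codes D))) => //.
- move=> y /zcupE[yl|/zsepE[/zpowE yl _]] z zy; apply/zcupE; left; last exact: yl.
  exact: lT zy.
- by move=> z zD; apply/zcupE; right.
apply/(card_lt_succ _ sm).
have -> : elts (zcup lambda (codes D)) = elts lambda `|` elts (codes D).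
  by rewrite predeqE => z; exact: zcupE.
apply: card_le_setU => //.
by rewrite elts_codes; exact: card_le_trans (card_image_le _ _) Dl.
Qed.

End Coding.

(** * Subcompact cardinals are strong limits *)

Section Subcompact.
Variable V : zfcUniverse.
Implicit Types (kappa lambda mu mubar A B : V).

(** If [r] were the successor of some [b], then [j r] would be the successor of [j b], which is [b],
    and [j] would fix its critical point. *)
Lemma crit_limit mubar mu B A (j : H mubar -> H mu) (r : H mubar) :
  is_cardinal mubar -> is_cardinal mu -> elementary B A j ->
  critical_point j r -> (exists x, x ∈ sval (j r)) -> limit_ordinal (sval r).
Proof.
move=> mbc muc jel [ro jr jfix] [x xr]; split=> //.
  apply: contrapT => r0; apply: ((j_empty mbc muc jel r).1 _ x xr).
  by move=> y yr; apply: r0; exists y.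
move=> b /[dup] br; have [b' <-] := H_elt mbc br => b'r.
have [//|rS] := ord_succ ro b'r; case: jr; rewrite rS.
by have /(j_succ mbc muc jel) := rS => ->; rewrite jfix.
Qed.

(** A trivially true sentence is reflected merely to obtain an embedding: its critical point is a
    limit ordinal below [kappa], so [kappa] is infinite. *)
Lemma subcompact_limit kappa mu : is_cardinal mu -> is_cardinal kappa ->
  Pi11_subcompact mu kappa -> limit_ordinal kappa.
Proof.
move=> muc kc sub; pose A := zsep kappa (fun=> False).
have [||rho [mb [B [rk [mbc _] _ _ [j [jel [r [er rc jr]]]]]]]] :=
  sub A _ (FImp (FFalse bool 0) (FFalse bool 0)).
- by move=> x /zsepE[].
- by move=> X _ /=.
apply: infinite_cardinal_limit => //.
apply: (@sub_infinite_set _ (elts rho)).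
  by move=> x; have [kT _] := kc.1; exact: kT.
apply: limit_infinite; rewrite -er; apply: crit_limit mbc muc jel rc _.
by rewrite jr; exists rho.
Qed.

Variables (kappa lambda mu : V).
Hypotheses (kc : is_cardinal kappa) (lc : is_cardinal lambda).
Hypotheses (kl : ord_le kappa lambda) (sm : is_succ_cardinal lambda mu).
Hypothesis sub : Pi11_subcompact mu kappa.

Let muc : is_cardinal mu. Proof. by case: sm. Qed.
Let klim : limit_ordinal kappa. Proof. exact: subcompact_limit muc kc sub. Qed.

Let kappa_sub_lambda : kappa ⊆ lambda.
Proof. by case: kl => [kl'|->//]; have [lT _] := lc.1; exact: lT. Qed.

Let llim : limit_ordinal lambda.
Proof.
apply: infinite_cardinal_limit => //.
by apply: (@sub_infinite_set _ (elts kappa)) => //; exact: limit_infinite.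
Qed.

Let H_lambda : in_H mu lambda. Proof. by case: sm => _ lm _; exact: in_H_lt. Qed.

Let H_sub_lambda x : x ⊆ lambda -> in_H mu x.
Proof. exact: in_H_subset. Qed.

Let H_kappa x : x ∈ kappa -> in_H mu x.
Proof. by move=> /kappa_sub_lambda; exact: in_H_elt. Qed.

(* Otherwise code f in A. The set s = f rho is bounded below the critical point,
   so j fixes it; its preimage under f then lies in the range of j, although it is rho. *)
Lemma subcompact_strong_limit g (f : V -> V) : g ∈ kappa ->
  (forall a, a ∈ kappa -> f a ⊆ g) ->
  (forall a b, a ∈ kappa -> b ∈ kappa -> f a = f b -> a = b) -> False.
Proof.
move=> gk fg finj; have [kT _] := kc.1.
have [w wP] := ztriple_bound (zcup kappa (zpow kappa)).
pose A := zsep w (fun t => exists a, a ∈ kappa /\ t = ztriple g a (f a)).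
have fk a : a ∈ kappa -> f a ⊆ kappa by move=> ak x /(fg _ ak); exact: kT.
have AP x y z : ztriple x y z ∈ A <-> [/\ x = g, y ∈ kappa & z = f y].
  split=> [/zsepE[_ [a [ak /ztriple_inj[-> -> ->]]]]//|[-> yk ->]].
  apply/zsepE; split; last by exists y.
  by apply: wP; apply/zcupE; [left|left|right; apply/zpowE; exact: fk].
have AH : subset_of_H mu A.
  move=> _ /zsepE[_ [a [ak ->]]]; apply: (in_H_ztriple sm llim); try exact: H_kappa.
  by apply: H_sub_lambda => z /(fk _ ak); exact: kappa_sub_lambda.
have [|rho [mb [B [rk [mbc _] BH _ [j [jel [r [er [ro _ jfix] jr]]]]]]]] :=
  sub AH (Phi := FImp (FFalse bool 0) (FFalse bool 0)); first by move=> X _ /=.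
(* All triples in [A] begin with [g], so the first entry of any triple in [B] is a preimage of
   [g]. *)
have [g1 [a1 [x1 h1]]] : exists x y z : H mb, ztriple (sval x) (sval y) (sval z) ∈ B.
  have Ht : ztriple g rho (f rho) ∈ A by apply/AP.
  have [Hx [Hy Hz]] := (fun p => conj p.1 (H_zpair muc p.2)) (H_zpair muc (AH _ Ht)).
  exact: (j_ex_triple mbc muc BH AH jel (x := exist _ _ Hx) (y := exist _ _ Hy)
           (z := exist _ _ Hz)).
have [jg _ _] : [/\ sval (j g1) = g, sval (j a1) ∈ kappa & sval (j x1) = f (sval (j a1))].
  by apply/AP; apply/(j_triple mbc muc BH AH jel).
have g1r : sval g1 ∈ sval r by apply/(j_mem jel); rewrite jg jr.
have g1g : sval g1 = g by rewrite -jg jfix.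
have rT : transitive_set (sval r) by case: ro.
have [s es] : exists s : H mb, sval s = f rho.
  have h : in_H mb (f rho).
    by apply: (in_H_subset mbc (svalP g1)); rewrite g1g; exact: fg.
  by exists (exist _ _ h).
have js : sval (j s) = f rho.
  have sg : sval s ⊆ sval g1 by rewrite es g1g; exact: fg.
  have jsg : sval (j s) ⊆ sval g1.
    by rewrite -(jfix _ g1r); apply/(j_sub mbc muc jel).
  rewrite -es; apply: zfc_extensionality => z; split=> zs.
    have zg := jsg _ zs; have [z' ez] := H_elt mbc zg.
    have jz : sval (j z') = z by rewrite jfix ez //; exact: rT zg.
    by rewrite -ez; apply/(j_mem jel); rewrite jz.
  have [z' ez] := H_elt mbc zs.
  have jz : sval (j z') = z by rewrite jfix ez //; apply: rT g1r _ _; exact: sg.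
  by rewrite -jz; apply/(j_mem jel); rewrite ez.
have [a ha] : exists y' : H mb, ztriple (sval g1) (sval y') (sval s) ∈ B.
  apply: (j_ex_triple2 mbc muc BH AH jel (y := exist _ _ (H_kappa rk))) => /=.
  by apply/AP; rewrite jg js.
have /AP[_ ak efa] := (j_triple mbc muc BH AH jel _ _ _).1 ha.
have ja : sval (j a) = rho by apply: finj => //; rewrite -efa js.
have ar : sval a ∈ sval r by apply/(j_mem jel); rewrite jr ja.
by move: (ar); rewrite -(jfix _ ar) ja er => /zin_irr.
Qed.

(** The counting form: subsets of [x] are copied into [b] along an injection, and an enumeration of
    [D] of length [kappa] would contradict the previous lemma. *)
Lemma subcompact_strong_limit_le (U : Type) (D : set U) b x (f : U -> V) :
  b ∈ kappa -> elts x #<= elts b -> (forall u, D u -> f u ⊆ x) ->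
  (forall u v, D u -> D v -> f u = f v -> u = v) -> card_lt D kappa.
Proof.
move=> bk xb fx finj; have [kD|//] := ord_compare D kc.1.
have [h [hb hinj]] := card_le_injE b xb.
have [u0 _] : exists u0 : U, True.
  apply: contrapT => nU; have [_ [k0 kk0] _] := klim.
  have D0 : D = set0 by rewrite predeqE => u; case: nU; exists u.
  by move: kD; rewrite D0 card_le0 => /eqP k0'; have : elts kappa k0 by []; rewrite k0'.
have [e [eD einj]] := card_le_injE u0 kD.
case: (@subcompact_strong_limit b
  (fun a => zsep b (fun y => exists2 z, z ∈ f (e a) & y = h z))) => //.
  by move=> a ak y /zsepE[].
have half a a' : a ∈ kappa -> a' ∈ kappa ->
    zsep b (fun y => exists2 z, z ∈ f (e a) & y = h z) =
    zsep b (fun y => exists2 z, z ∈ f (e a') & y = h z) -> f (e a) ⊆ f (e a').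
  move=> ak ak' ee z zf; have zx := fx _ (eD _ ak) _ zf.
  have : h z ∈ zsep b (fun y => exists2 z, z ∈ f (e a) & y = h z).
    by apply/zsepE; split; [exact: hb|exists z].
  rewrite ee => /zsepE[_ [z' zf' /hinj ->//]].
  exact: fx (eD _ ak') _ zf'.
move=> a a' ak ak' ee; apply: einj => //; apply: finj; try exact: eD.
by apply: zfc_extensionality => z; split; apply: half.
Qed.

(** * Filter extension *)

Local Notation T := {x : V | x ∈ lambda}.

Let H_code (S : set T) : in_H mu (code S).
Proof. by apply: in_H_subset muc H_lambda _; exact: code_sub. Qed.

Let card_lt_lambda (D : set (set T)) : card_lt D kappa -> D #<= elts lambda.
Proof.
move=> [a ak /card_eqW[Da _]]; apply: (card_le_trans Da).
apply: subset_card_le => x xa; apply: kappa_sub_lambda.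
by have [[kT _] _ _] := klim; exact: kT xa.
Qed.

Lemma enum_exists : exists e : set (set T) -> set T -> V, forall D, card_lt D kappa ->
  (exists2 g, g ∈ kappa & forall S, D S -> e D S ∈ g) /\
  (forall S S', D S -> D S' -> e D S = e D S' -> S = S').
Proof.
suff /choice[e eP] : forall D, exists e : set T -> V, card_lt D kappa ->
    (exists2 g, g ∈ kappa & forall S, D S -> e S ∈ g) /\
    (forall S S', D S -> D S' -> e S = e S' -> S = S') by exists e.
move=> D.
have [h|h] := pselect (card_lt D kappa); last by exists (fun=> kappa).
have [g gk /card_eqW[Dg _]] := h.
by have [e [eg einj]] := card_le_injE kappa Dg; exists e => _; split=> //; exists g.
Qed.

Variables (F : set_system T) (FP : ProperFilter F) (Fc : kcomplete kappa F).
Variable e : set (set T) -> set T -> V.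
Hypothesis eP : forall D, card_lt D kappa ->
  (exists2 g, g ∈ kappa & forall S, D S -> e D S ∈ g) /\
  (forall S S', D S -> D S' -> e D S = e D S' -> S = S').

(* The triples [(codes D, e D S, code S)] enumerate the small families D of
   subsets of lambda; the triples [(x, x, x)], never of this form by
   foundation, list the elements of F. *)
Definition coded x y z :=
  (exists D S, [/\ card_lt D kappa, D S & [/\ x = codes D, y = e D S & z = code S]]) \/
  (exists S, F S /\ [/\ x = code S, y = code S & z = code S]).

Lemma coded_set : exists2 A : V, subset_of_H mu A &
  forall x y z, ztriple x y z ∈ A <-> coded x y z.
Proof.
have [w wP] := ztriple_bound (zcup (zcup lambda (zpow lambda)) (zpow (zpow lambda))).
exists (zsep w (fun t => exists x y z, coded x y z /\ t = ztriple x y z)).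
  move=> _ /zsepE[_ [x [y [z [h ->]]]]].
  case: h => [[D [S [Dk DS [-> -> ->]]]]|[S [_ [-> -> ->]]]];
    apply: (in_H_ztriple sm llim) => //.
    exact/codes_in_H/card_lt_lambda.
  by have [[g gk /(_ _ DS) h] _] := eP Dk; apply: in_H_elt muc (H_kappa gk) h.
move=> x y z; split=> [/zsepE[_ [x' [y' [z' [h /ztriple_inj[-> -> ->]]]]]]//|h].
apply/zsepE; split; last by exists x, y, z.
have cP (S : set T) : code S ∈ zpow lambda by apply/zpowE; exact: code_sub.
case: h => [[D [S [Dk DS [-> -> ->]]]]|[S [_ [-> -> ->]]]].
  apply: wP; rewrite !zcupE; auto.
  - by right; apply/zpowE => y' /zsepE[].
  - have [[g gk /(_ _ DS) h] _] := eP Dk; left; left; apply: kappa_sub_lambda.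
    by have [[kT _] _ _] := klim; exact: kT h.
by apply: wP; rewrite !zcupE; auto.
Qed.

Variable A : V.
Hypotheses (AH : subset_of_H mu A).
Hypothesis AP : forall x y z, ztriple x y z ∈ A <-> coded x y z.

Lemma coded_F x : relF A x <-> exists2 S, F S & x = code S.
Proof.
split=> [/AP[[D [S [_ DS [-> _ /esym ee]]]]|[S [FS [-> _ _]]]]|[S FS ->]].
- by have := (codesE D S).2 DS; rewrite ee => /zin_irr.
- by exists S.
- by apply/AP; right; exists S.
Qed.

Lemma coded_E x y z : relE A x y z <->
  exists D S, [/\ card_lt D kappa, D S & [/\ x = codes D, y = e D S & z = code S]].
Proof.
split=> [[/AP[//|[S [_ [-> _ ->]]]]]//|[D [S [Dk DS [-> -> ->]]]]].
split; first by apply/AP; left; exists D, S.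
by have := (codesE D S).2 DS => h ee; move: h; rewrite ee => /zin_irr.
Qed.

(** Numbers determine members because each enumeration is injective. This later identifies a member
    of j(D) with an image under j. *)
Lemma coded_E_fun x y z z' : relE A x y z -> relE A x y z' -> z = z'.
Proof.
move=> /coded_E[D [S [Dk DS [-> -> ->]]]] /coded_E[D' [S' [_ DS' [/codes_inj eD ee ->]]]].
by subst D'; have [_ einj] := eP Dk; rewrite (einj _ _ DS DS' ee).
Qed.

(** Stated for every [x], since it is applied to images under [j], which are not known to code
    families; without a family the bound is vacuous. *)
Lemma coded_bounded x : exists2 g, g ∈ kappa & bounded A x g.
Proof.
have [[D [Dk ->]]|nD] := pselect (exists D : set (set T), card_lt D kappa /\ x = codes D).
  have [[g gk gP] _] := eP Dk; exists g => // a d /coded_E[D' [S [_ DS [+ -> _]]]].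
  by move=> /codes_inj eD; rewrite -eD; apply: gP; rewrite eD.
have [_ [k0 kk0] _] := klim; exists k0 => // a d /coded_E[D [S [Dk _ [ex _ _]]]].
by case: nD; exists D.
Qed.

Lemma coded_top l : isTop A l <-> l = lambda.
Proof.
have FL : relF A lambda by apply/coded_F; exists setT; rewrite ?codeT //; exact: filterT.
split=> [[/coded_F[S FS ->] h]|->].
  apply: zfc_extensionality => z; split=> [/code_sub//|]; exact: h.
by split=> // x /coded_F[S _ ->]; exact: code_sub.
Qed.

Lemma good_extension X : good mu A X -> exists U : set_system T,
  [/\ UltraFilter U, kcomplete kappa U & F `<=` U].
Proof.
move=> /(_ lambda ((coded_top _).2 erefl))[h1 h2 h3].
pose U : set_system T := [set S | code S ∈ X].
have FU : F `<=` U by move=> S FS; apply: h1; apply/coded_F; exists S.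
have Uc : kcomplete kappa U.
  move=> D DU Dk; apply: (h3 (codes D)) => //.
  - exact/codes_in_H/card_lt_lambda.
  - by move=> a d /coded_E[D' [S [_ DS [/codes_inj eD _ ->]]]]; apply: DU; rewrite eD.
  move=> b; split=> [/code_elt[t tD <-]|[bl hb]].
    split; first exact: (svalP t).
    move=> a d /coded_E[D' [S [_ DS [/codes_inj eD _ ->]]]].
    have {}DS : D S by rewrite eD.
    by apply/codeE; exact: tD.
  apply: ((codeE _ (exist _ b bl)).2) => S DS; apply/codeE.
  by apply: (hb (e D S)); apply/coded_E; exists D, S.
exists U; split=> //; apply: ultrafilter_decide.
- by apply: FU; exact: filterT.
- by move=> S; apply: h2 => //; exact: code_compl.
move=> S S' US US'.
have -> : S `&` S' = \bigcap_(Y in [set S; S']) Y.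
  rewrite predeqE => t; split=> [[St St'] Y [->|->]//|h].
  by split; apply: h; [left|right].
apply: Uc; first by move=> _ [->|->].
(* Binary intersections are an instance of completeness, as a pair is smaller than the infinite
   [kappa]. *)
have [kf|//] := ord_compare [set S; S'] kc.1.
case: (limit_infinite klim); apply: card_le_finite kf _; exact: finite_set2.
Qed.

(* A point b of lambda in every [j x], for x in the filter coded by B, generates
   the ultrafilter [{x | b \in j x}]. *)
Lemma reflected_good mubar B (j : H mubar -> H mu) (r : H mubar) :
  is_cardinal mubar -> mubar ∈ kappa -> subset_of_H mubar B -> elementary B A j ->
  critical_point j r -> sval (j r) = kappa ->
  exists2 X, subset_of_H mubar X & good mubar B X.
Proof.
move=> mbc mbk BH jel [ro _ jfix] jr.
have [l /[dup] tl] : exists l : H mubar, isTop B (sval l).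
  by apply: (j_ex_top mbc muc BH AH jel (l := exist _ _ H_lambda)); exact/coded_top.
move=> /(j_top mbc muc BH AH jel)/coded_top jl.
pose D0 : set (set T) :=
  [set S | exists2 x : H mubar, relF B (sval x) & code S = sval (j x)].
have D0F : D0 `<=` F.
  move=> S [x /(j_triple mbc muc BH AH jel) Fx eS].
  by move/coded_F: Fx => [S' FS']; rewrite -eS => /code_inj ->.
have D0k : card_lt D0 kappa.
  (* Membership of [l] in H(mubar) bounds its size by some [b] below mubar, hence below [kappa];
     [D0] injects into the subsets of [l]. *)
  have [t [tT lt _] [b bmb /card_eqW[tb _]]] := svalP l.
  have bk : b ∈ kappa by have [[kT _] _ _] := klim; exact: kT bmb.
  have /choice[f fP] : forall S, exists x : H mubar, D0 S ->
      relF B (sval x) /\ code S = sval (j x).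
    move=> S; have [[x Fx eS]|nS] := pselect (D0 S); first by exists x.
    by exists l.
  apply: (subcompact_strong_limit_le (b := b) (x := sval l)
            (f := fun S => sval (f S))) => //.
  - by apply: card_le_trans tb; exact: subset_card_le.
  - by move=> S /fP[Fx _]; exact: tl.2.
  - move=> S S' /fP[_ eS] /fP[_ eS'] /H_eq ff; apply: code_inj.
    by rewrite eS eS' ff.
have [b bD0] : exists b : T, (\bigcap_(S in D0) S) b.
  by apply: (@filter_ex _ F FP); exact: Fc.
pose inY (x : V) := exists2 x' : H mubar, sval x' = x & sval b ∈ sval (j x').
pose Y := zsep (zpow (sval l)) inY.
have YP (x : H mubar) : sval x ⊆ sval l -> (sval x ∈ Y <-> sval b ∈ sval (j x)).
  move=> xl; split=> [/zsepE[_ [x' /H_eq ->]]//|bx].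
  by apply/zsepE; split; [exact/zpowE|exists x].
exists Y; first by move=> _ /zsepE[_ [x' <- _]]; exact: svalP.
have rT : transitive_set (sval r) by case: ro.
move=> l' tl'.
have {tl'} -> : l' = sval l.
  by apply: zfc_extensionality => z; split; [apply: tl.2 tl'.1 z|apply: tl'.2 tl.1 z].
split.
- move=> x Fx; have Hx := relF_H mbc BH Fx.
  apply/(YP (exist _ x Hx)); first exact: tl.2.
  have /(j_triple mbc muc BH AH jel)/coded_F[S FS eS] :
    relF B (sval (exist (in_H mubar) x Hx)) by [].
  by rewrite eS; apply/codeE; apply: bD0; exists (exist _ x Hx).
- move=> x y Hx Hy cxy; have [xl yP] := cxy.
  have yl : y ⊆ sval l by move=> z /yP[].
  rewrite (YP (exist _ x Hx) xl) (YP (exist _ y Hy) yl).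
  have [_ jyP] := (j_compl mbc muc jel _ (exist _ x Hx) (exist _ y Hy)).1 cxy.
  rewrite jyP jl; split=> [bx [_ nbx]//|h]; apply: contrapT => nbx; apply: h.
  by split=> //; exact: (svalP b).
- move=> D z HD Hz hD zP.
  have zl : z ⊆ sval l by move=> u /zP[].
  apply/(YP (exist _ z Hz) zl).
  apply/((j_inter mbc muc BH AH jel _ (exist _ D HD) (exist _ z Hz)).1 zP).
  rewrite jl; split=> [|a d Ead]; first exact: (svalP b).
  (* The bound is pulled back from [j r], which is [kappa], to [r], where [j] is the identity; every
     number used by j(D) is then below [g] and fixed. *)
  have [g gr gD] : exists2 g, g ∈ sval r & bounded B D g.
    apply/(j_bounded mbc muc BH AH jel r (exist _ D HD)).
    by rewrite jr; exact: coded_bounded.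
  have [g' eg] := H_elt mbc gr.
  have ag : a ∈ sval (j g').
    apply: ((j_bounded_at mbc muc BH AH jel (exist _ D HD) g').1 _ _ _ Ead).
    by rewrite eg.
  rewrite (jfix g') eg // in ag.
  have ar : a ∈ sval r by exact: rT ag.
  have [a' ea] := H_elt mbc ar.
  have ja : sval (j a') = a by rewrite jfix ea.
  have [_ _ Hd] := relE_H muc AH Ead.
  (* That j(D) has a member number [a] reflects to [D]; uniqueness then gives that [d] is the image
     of [d'], whose membership in [Y] says that [b] lies in [d]. *)
  have [d' Ed'] : exists d' : H mubar, relE B D (sval a') (sval d').
    apply: (j_ex_relE mbc muc BH AH jel (D := exist _ D HD) (d := exist _ d Hd)).
    by rewrite ja.
  have jEd := (j_relE mbc muc BH AH jel (exist _ D HD) a' d').1 Ed'.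
  rewrite ja in jEd; rewrite (coded_E_fun Ead jEd).
  have := hD _ _ Ed' => /[dup] /zsepE[/zpowE d'l _].
  by move=> /(YP _ d'l).
Qed.

End Subcompact.

Theorem theorem3p2 (V : zfcUniverse) :
  (forall kappa lambda lambda_plus : V,
     is_cardinal kappa -> is_cardinal lambda -> ord_le kappa lambda ->
     is_succ_cardinal lambda lambda_plus ->
     Pi11_subcompact lambda_plus kappa ->
     filter_extension_property lambda kappa) /\
  (forall kappa kappa_plus : V,
     is_cardinal kappa -> is_succ_cardinal kappa kappa_plus ->
     Pi11_subcompact kappa_plus kappa ->
     self_compact kappa).
Proof.
have main (kappa lambda mu : V) : is_cardinal kappa -> is_cardinal lambda ->
    ord_le kappa lambda -> is_succ_cardinal lambda mu ->
    Pi11_subcompact mu kappa -> filter_extension_property lambda kappa.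
  move=> kc lc kl sm sub F FP Fc; apply: contrapT => noU.
  have [e eP] := enum_exists kappa lambda.
  have [A AH AP] := coded_set kc lc kl sm sub F eP.
  have [muc _ _] := sm.
  have AS : sat_Pi11 mu A (fNot fGood).
    move=> X XH /(sat_fGood X muc AH) gX; apply: noU.
    exact: (good_extension kc lc kl sm sub FP AP gX).
  have [rho [mb [B [_ [mbc mbk] BH BS [j [jel [r [_ rc jr]]]]]]]] := sub _ AH _ AS.
  have [X XH gX] := reflected_good kc lc kl sm sub FP Fc eP AH AP mbc mbk BH jel rc jr.
  by apply: (BS X XH); apply/(sat_fGood X mbc BH).
split=> // kappa mu kc sm sub; apply: (main _ _ mu) => //; by right.
Qed.
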